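(* For $|q|<1$, \begin{align*} S_0(q^2)+2T_0(q^2)&=\frac{(q^2;q^2)_{\infty}\left[(q;q^2)^3_{\infty}+(-q;q^2)^3_{\infty}\right]}{2(-q^2;q^2)_{\infty}},\\ S_1(q^2)+2T_1(q^2)&=\frac{(q^2;q^2)_{\infty}\left[(-q;q^2)^3_{\infty}-(q;q^2)^3_{\infty}\right]}{2q(-q^2;q^2)_{\infty}}. \end{align*}
   Context: For $n\ge 0$, $(a;q)_n=\prod_{j=0}^{n-1}(1-aq^j)$, $(a;q)_\infty=\prod_{j\ge0}(1-aq^j)$. Eighth order mock theta functions: $S_0(q)=\sum_{n\ge0}\frac{q^{n^2}(-q;q^2)_n}{(-q^2;q^2)_n}$, $S_1(q)=\sum_{n\ge0}\frac{q^{n(n+2)}(-q;q^2)_n}{(-q^2;q^2)_n}$, $T_0(q)=\sum_{n\ge0}\frac{q^{(n+1)(n+2)}(-q^2;q^2)_n}{(-q;q^2)_{n+1}}$, $T_1(q)=\sum_{n\ge0}\frac{q^{n(n+1)}(-q^2;q^2)_n}{(-q;q^2)_{n+1}}$. *)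

(* Defs.v *)
From Stdlib Require Import Reals.
Open Scope R_scope.

Definition Cx : Type := (R * R)%type.
Definition RtoC (x : R) : Cx := (x, 0).
Definition C0 : Cx := (0, 0).
Definition C1 : Cx := (1, 0).
Definition Cadd (z w : Cx) : Cx := (fst z + fst w, snd z + snd w).
Definition Copp (z : Cx) : Cx := (- fst z, - snd z).
Definition Csub (z w : Cx) : Cx := Cadd z (Copp w).
Definition Cmul (z w : Cx) : Cx :=
  (fst z * fst w - snd z * snd w, fst z * snd w + snd z * fst w).
Definition Cinv (z : Cx) : Cx :=
  let d := fst z * fst z + snd z * snd z in (fst z / d, - snd z / d).
Definition Cdiv (z w : Cx) : Cx := Cmul z (Cinv w).
Definition Cnorm (z : Cx) : R := sqrt (fst z * fst z + snd z * snd z).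
Fixpoint Cpow (z : Cx) (n : nat) : Cx :=
  match n with O => C1 | S m => Cmul z (Cpow z m) end.

Definition Ccv (u : nat -> Cx) (l : Cx) : Prop :=
  forall eps : R, eps > 0 -> exists N : nat, forall n : nat,
    (n >= N)%nat -> Cnorm (Csub (u n) l) < eps.

Fixpoint Cpsum (f : nat -> Cx) (n : nat) : Cx :=
  match n with O => C0 | S m => Cadd (Cpsum f m) (f m) end.
Definition Cseries (f : nat -> Cx) (L : Cx) : Prop := Ccv (Cpsum f) L.

Fixpoint qpoch (a q : Cx) (n : nat) : Cx :=
  match n with
  | O => C1
  | S m => Cmul (qpoch a q m) (Csub C1 (Cmul a (Cpow q m)))
  end.
Definition qpoch_inf (a q L : Cx) : Prop := Ccv (qpoch a q) L.

(* Summands of the eighth order mock theta functions, as functions of q. *)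
Definition S0_term (q : Cx) (n : nat) : Cx :=
  Cdiv (Cmul (Cpow q (n * n)) (qpoch (Copp q) (Cpow q 2) n))
       (qpoch (Copp (Cpow q 2)) (Cpow q 2) n).
Definition S1_term (q : Cx) (n : nat) : Cx :=
  Cdiv (Cmul (Cpow q (n * (n + 2))) (qpoch (Copp q) (Cpow q 2) n))
       (qpoch (Copp (Cpow q 2)) (Cpow q 2) n).
Definition T0_term (q : Cx) (n : nat) : Cx :=
  Cdiv (Cmul (Cpow q ((n + 1) * (n + 2))) (qpoch (Copp (Cpow q 2)) (Cpow q 2) n))
       (qpoch (Copp q) (Cpow q 2) (S n)).
Definition T1_term (q : Cx) (n : nat) : Cx :=
  Cdiv (Cmul (Cpow q (n * (n + 1))) (qpoch (Copp (Cpow q 2)) (Cpow q 2) n))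
       (qpoch (Copp q) (Cpow q 2) (S n)).

(* Main.v *)
(* Continued to negative n, the summand of S_0 at n = -(j+1) is twice the summand of T_0 at j,
   and likewise for S_1 and T_1: S_0 + 2 T_0 and S_1 + 2 T_1 are bilateral series. The
   combination (S_0 + 2 T_0)(q^2) + q (S_1 + 2 T_1)(q^2) is
     sum over all integers n of q^(2n^2) (1 + q^(4n+1)) (-q^2;q^4)_n / (-q^4;q^4)_n,
   which is a limiting case of Bailey's 6psi6 sum (base q^2, a = -q, b = iq, c = -iq, and
   d, e -> oo) with value A C^3 / D, where A = (q^2;q^2)_oo, C = (-q;q^2)_oo and
   D = (-q^2;q^2)_oo. Replacing q by -q changes C into B = (q;q^2)_oo and separates the even
   and odd parts, which are the two claims.
   The bilateral sum is the limit m -> oo, by Tannery's theorem, of the terminating identity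
     sum over |n| <= m of q^(2n^2) (1 + q^(4n+1)) (-q^2;q^4)_n / (-q^4;q^4)_n
       / (A_(m-n) A_(m+n) C_(m-n) C_(m+n+1))  =  C_(2m) / (A_(2m) D_(2m)),
   where A_k = (q^2;q^2)_k, C_k = (-q;q^2)_k and D_k = (-q^2;q^2)_k; this is proved by
   induction on m, telescoping in n with a Wilf-Zeilberger certificate. *)
From Stdlib Require Import Reals Lra Lia.
From Coquelicot Require Import Coquelicot.
Require Import Defs.
Open Scope R_scope.

(** * Agreement of the elementary definitions with Coquelicot's complex numbers *)

Lemma Cinv_Coquelicot (z : C) : Cinv z = Complex.Cinv z.
Proof.
  unfold Cinv, Complex.Cinv; f_equal; f_equal; simpl; ring.
Qed.

Lemma Cdiv_Coquelicot (z w : C) : Cdiv z w = Complex.Cdiv z w.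
Proof.
  unfold Cdiv, Complex.Cdiv; now rewrite Cinv_Coquelicot.
Qed.

Lemma Cpow_Coquelicot (z : C) (n : nat) : Cpow z n = Complex.Cpow z n.
Proof.
  induction n as [|n IH]; [reflexivity|].
  simpl Cpow; rewrite IH, Cpow_S; reflexivity.
Qed.

Lemma Cnorm_Cmod (z : C) : Cnorm z = Cmod z.
Proof.
  unfold Cnorm, Cmod; f_equal; ring.
Qed.

Lemma Cplus_0_inj (z w : C) : (0 + z = 0 + w)%C -> z = w.
Proof.
  now rewrite !Cplus_0_l.
Qed.

(* [ring] reads the type off the left-hand side, which has to be [C] rather than the
   convertible [Cx]. *)
Ltac Cring := apply Cplus_0_inj; ring.

Local Open Scope C_scope.

(** * Limits, series and dominated convergence over the complex numbers *)

(** The modulus lies between the larger of the two absolute coordinates and their sum. This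
    transfers the real limit theorems to complex sequences. *)
Lemma Ccv_iff (u : nat -> C) (l : C) :
  Ccv u l <->
  is_lim_seq (fun n => Re (u n)) (Re l) /\ is_lim_seq (fun n => Im (u n)) (Im l).
Proof.
  split.
  - intros H; split; apply is_lim_seq_spec; intros [eps Heps];
      destruct (H eps Heps) as [N HN]; exists N; intros n Hn; simpl;
      specialize (HN n Hn); rewrite Cnorm_Cmod in HN;
      change (Csub (u n) l) with (u n - l) in HN;
      pose proof (Rmax_Cmod (u n - l)) as M;
      change (fst (u n - l)) with (Re (u n) - Re l)%R in M;
      change (snd (u n - l)) with (Im (u n) - Im l)%R in M.
    + eapply Rle_lt_trans; [|exact HN]; eapply Rle_trans; [apply Rmax_l|exact M].
    + eapply Rle_lt_trans; [|exact HN]; eapply Rle_trans; [apply Rmax_r|exact M].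
  - intros [H1 H2] eps Heps.
    apply is_lim_seq_spec in H1; apply is_lim_seq_spec in H2.
    assert (He : 0 < eps / 2) by lra.
    destruct (H1 (mkposreal _ He)) as [N1 HN1], (H2 (mkposreal _ He)) as [N2 HN2].
    exists (max N1 N2); intros n Hn.
    specialize (HN1 n ltac:(lia)); specialize (HN2 n ltac:(lia)); simpl in HN1, HN2.
    rewrite Cnorm_Cmod; change (Csub (u n) l) with (u n - l).
    replace (u n - l) with ((Re (u n) - Re l)%R + Ci * (Im (u n) - Im l)%R)
      by (unfold Cminus, Complex.Copp, Cplus, Cmult, Ci, Re, Im; simpl; f_equal; ring).
    eapply Rle_lt_trans; [apply Cmod_triangle|].
    rewrite Cmod_mult, Cmod_Ci, !Cmod_R; lra.
Qed.

Lemma Ccv_ext (u v : nat -> C) (l : C) :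
  (forall n, u n = v n) -> Ccv u l -> Ccv v l.
Proof.
  intros E H eps Heps; destruct (H eps Heps) as [N HN]; exists N; intros n Hn.
  rewrite <- E; auto.
Qed.

Lemma Ccv_const (l : C) : Ccv (fun _ => l) l.
Proof.
  apply Ccv_iff; split; apply is_lim_seq_const.
Qed.

Lemma Ccv_plus (u v : nat -> C) (l l' : C) :
  Ccv u l -> Ccv v l' -> Ccv (fun n => u n + v n) (l + l').
Proof.
  intros [H1 H2]%Ccv_iff [H3 H4]%Ccv_iff; apply Ccv_iff; split.
  - exact (is_lim_seq_plus' _ _ _ _ H1 H3).
  - exact (is_lim_seq_plus' _ _ _ _ H2 H4).
Qed.

Lemma Ccv_mult (u v : nat -> C) (l l' : C) :
  Ccv u l -> Ccv v l' -> Ccv (fun n => u n * v n) (l * l').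
Proof.
  intros [H1 H2]%Ccv_iff [H3 H4]%Ccv_iff; apply Ccv_iff; split.
  - exact (is_lim_seq_minus' _ _ _ _ (is_lim_seq_mult' _ _ _ _ H1 H3)
             (is_lim_seq_mult' _ _ _ _ H2 H4)).
  - exact (is_lim_seq_plus' _ _ _ _ (is_lim_seq_mult' _ _ _ _ H1 H4)
             (is_lim_seq_mult' _ _ _ _ H2 H3)).
Qed.

Lemma Ccv_inv (u : nat -> C) (l : C) :
  l <> 0 -> Ccv u l -> Ccv (fun n => / u n) (/ l).
Proof.
  intros Hl [H1 H2]%Ccv_iff.
  assert (Hd : (Re l * Re l + Im l * Im l)%R <> 0%R).
  { intros E; apply Hl.
    apply injective_projections; unfold Re, Im in E; simpl; nra. }
  pose proof (is_lim_seq_plus' _ _ _ _ (is_lim_seq_mult' _ _ _ _ H1 H1)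
             (is_lim_seq_mult' _ _ _ _ H2 H2)) as Hn.
  apply (Ccv_ext (fun n => Cinv (u n))); [intros n; apply Cinv_Coquelicot|].
  rewrite <- Cinv_Coquelicot; apply Ccv_iff; split.
  - exact (is_lim_seq_div' _ _ _ _ H1 Hn Hd).
  - assert (H2' : is_lim_seq (fun n => - Im (u n))%R (- Im l)%R)
      by (apply is_lim_seq_opp in H2; exact H2).
    exact (is_lim_seq_div' _ _ _ _ H2' Hn Hd).
Qed.

Lemma Ccv_unique (u : nat -> C) (l l' : C) : Ccv u l -> Ccv u l' -> l = l'.
Proof.
  intros [H1 H2]%Ccv_iff [H3 H4]%Ccv_iff.
  apply is_lim_seq_unique in H1, H2, H3, H4.
  apply injective_projections.
  - rewrite H1 in H3; injection H3; auto.
  - rewrite H2 in H4; injection H4; auto.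
Qed.

(** The assumption on [phi] is divergence to infinity, which covers index maps such as [m - k] and
    [2 * m]. *)
Lemma Ccv_subseq (u : nat -> C) (l : C) (phi : nat -> nat) :
  (forall N, exists M, forall n, (M <= n)%nat -> (N <= phi n)%nat) ->
  Ccv u l -> Ccv (fun n => u (phi n)) l.
Proof.
  intros Hphi H eps Heps; destruct (H eps Heps) as [N HN].
  destruct (Hphi N) as [M HM]; exists M; intros n Hn.
  apply HN, HM, Hn.
Qed.

Lemma Cpsum_0 (f : nat -> C) : Cpsum f 0 = (0 : C).
Proof. reflexivity. Qed.

Lemma Cpsum_S (f : nat -> C) (n : nat) : Cpsum f (S n) = Cpsum f n + f n.
Proof. reflexivity. Qed.

Lemma Cpsum_ext (f g : nat -> C) (n : nat) :
  (forall k, (k < n)%nat -> f k = g k) -> Cpsum f n = Cpsum g n.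
Proof.
  induction n as [|n IH]; intros H; [reflexivity|].
  rewrite !Cpsum_S, IH, H; auto.
Qed.

Lemma Cpsum_plus (f g : nat -> C) (n : nat) :
  Cpsum (fun k => f k + g k) n = Cpsum f n + Cpsum g n.
Proof.
  induction n as [|n IH]; [rewrite !Cpsum_0; Cring|].
  rewrite !Cpsum_S, IH; Cring.
Qed.

Lemma Cpsum_scal (c : C) (f : nat -> C) (n : nat) :
  Cpsum (fun k => c * f k) n = c * Cpsum f n.
Proof.
  induction n as [|n IH]; [rewrite !Cpsum_0; Cring|].
  rewrite !Cpsum_S, IH; Cring.
Qed.

Lemma Cseries_geometric_bound (f : nat -> C) (K r : R) :
  (0 <= r < 1)%R -> (forall n, (Cmod (f n) <= K * r ^ n)%R) ->
  exists L, Cseries f L.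
Proof.
  intros Hr Hf.
  assert (G : ex_series (fun n => K * r ^ n)%R).
  { apply (ex_series_scal (V := R_NormedModule) K), ex_series_geom;
      rewrite Rabs_pos_eq; lra. }
  (* [p] stands for the real and the imaginary part in turn. *)
  assert (Hc : forall p : C -> R, (forall z, (Rabs (p z) <= Cmod z)%R) ->
             (p (0%R, 0%R) = 0%R) -> (forall z w, p (z + w) = (p z + p w)%R) ->
             exists l, is_lim_seq (fun n => p (Cpsum f n)) (Finite l)).
  { intros p Hp p0 padd.
    destruct (@ex_series_le R_AbsRing R_CompleteNormedModule
               (fun n => p (f n)) _ (fun n => Rle_trans _ _ _ (Hp (f n)) (Hf n)) G)
      as [l Hl].
    (* [sum_n] includes the term of index [n], whereas [Cpsum] stops just before it; hence the shift
       by one. *)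
    exists l; apply is_lim_seq_incr_1.
    apply (is_lim_seq_ext (sum_n (fun n => p (f n)))); [|exact Hl].
    intros n; induction n as [|n IH].
    - rewrite sum_O, Cpsum_S, padd; change (Cpsum f 0) with ((0%R, 0%R) : C); rewrite p0; ring.
    - rewrite sum_Sn, IH, (Cpsum_S f (S n)), padd; reflexivity. }
  destruct (Hc Re) as [x Hx];
    [intros z; eapply Rle_trans; [apply Rmax_l|apply Rmax_Cmod] | reflexivity | reflexivity |].
  destruct (Hc Im) as [y Hy];
    [intros z; eapply Rle_trans; [apply Rmax_r|apply Rmax_Cmod] | reflexivity | reflexivity |].
  exists (x, y); apply Ccv_iff; split; assumption.
Qed.

Lemma Cmod_Cpsum_geometric (f : nat -> C) (K r : R) (N n : nat) :
  (0 <= r < 1)%R -> (0 <= K)%R ->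
  (forall k, (k < n)%nat -> (Cmod (f k) <= K * r ^ (N + k))%R) ->
  (Cmod (Cpsum f n) <= K * r ^ N / (1 - r))%R.
Proof.
  intros Hr HK Hf.
  (* The exact finite geometric sum is the bound that passes through the induction. *)
  enough (E : (Cmod (Cpsum f n) <= K * r ^ N * (1 - r ^ n) / (1 - r))%R).
  { eapply Rle_trans; [exact E|]; unfold Rdiv; apply Rmult_le_compat_r.
    - left; apply Rinv_0_lt_compat; lra.
    - assert (0 <= r ^ n)%R by (apply pow_le; lra).
      assert (0 <= K * r ^ N)%R by (apply Rmult_le_pos; [lra|apply pow_le; lra]).
      nra. }
  induction n as [|n IH].
  - rewrite Cpsum_0, Cmod_0; simpl; right; field; lra.
  - rewrite Cpsum_S; eapply Rle_trans; [apply Cmod_triangle|].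
    specialize (Hf n ltac:(lia)) as Hn; specialize (IH (fun k Hk => Hf k ltac:(lia))).
    rewrite pow_add in Hn.
    replace (K * r ^ N * (1 - r ^ S n) / (1 - r))%R
      with (K * r ^ N * (1 - r ^ n) / (1 - r) + K * (r ^ N * r ^ n))%R
      by (simpl; field; lra).
    lra.
Qed.

Lemma Cpsum_add (f : nat -> C) (N n : nat) :
  Cpsum f (N + n) = Cpsum f N + Cpsum (fun k => f (N + k)%nat) n.
Proof.
  induction n as [|n IH].
  - rewrite Nat.add_0_r; rewrite Cpsum_0; Cring.
  - rewrite Nat.add_succ_r, !Cpsum_S, IH; Cring.
Qed.

Lemma Ccv_Cpsum (f : nat -> nat -> C) (g : nat -> C) (n : nat) :
  (forall k, Ccv (fun m => f m k) (g k)) ->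
  Ccv (fun m => Cpsum (f m) n) (Cpsum g n).
Proof.
  intros H; induction n as [|n IH]; [exact (Ccv_const 0)|].
  exact (Ccv_plus _ _ _ _ IH (H n)).
Qed.

Lemma geometric_tail_lt (K r eps : R) :
  (0 <= r < 1)%R -> (0 < eps)%R -> exists N, (K * r ^ N / (1 - r) < eps)%R.
Proof.
  intros Hr He.
  assert (L : is_lim_seq (fun n => K * r ^ n / (1 - r))%R (K * 0 / (1 - r))%R).
  { apply is_lim_seq_div'; [|apply is_lim_seq_const|lra].
    apply is_lim_seq_mult'; [apply is_lim_seq_const|].
    apply is_lim_seq_geom; rewrite Rabs_pos_eq; lra. }
  apply is_lim_seq_spec in L; destruct (L (mkposreal _ He)) as [N HN].
  exists N; specialize (HN N (Nat.le_refl N)); simpl in HN.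
  apply Rabs_def2 in HN; replace (K * 0 / (1 - r))%R with 0%R in HN by (field; lra).
  lra.
Qed.

(** Dominated convergence for weights with a common limit. Of the sum of u k (w m k - W), the first
    [N] terms tend to 0 as a finite sum, and the geometric majorant makes the rest small uniformly
    in [m]. *)
Lemma tannery (u : nat -> C) (w : nat -> nat -> C) (W U : C) (K M r : R)
  (phi : nat -> nat) :
  (0 <= r < 1)%R ->
  (forall k, (Cmod (u k) <= K * r ^ k)%R) ->
  (forall m k, (k < phi m)%nat -> (Cmod (w m k) <= M)%R) ->
  (forall k, Ccv (fun m => w m k) W) ->
  (forall m, (m <= phi m)%nat) ->
  Cseries u U ->
  Ccv (fun m => Cpsum (fun k => u k * w m k) (phi m)) (U * W).
Proof.
  intros Hr Hu Hw Hcv Hphi HU.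
  assert (HUphi : Ccv (fun m => Cpsum u (phi m)) U).
  { apply Ccv_subseq; [|exact HU]; intros N; exists N; intros n Hn.
    specialize (Hphi n); lia. }
  set (d := fun m k => u k * (w m k - W)).
  assert (HK : (0 <= K)%R).
  { specialize (Hu 0%nat); pose proof (Cmod_ge_0 (u 0%nat)); simpl in Hu; lra. }
  (* Since [1 <= phi 1], the pair [m = 1], [k = 0] is admissible and forces [M] to be
     nonnegative. *)
  assert (HM : (0 <= M + Cmod W)%R).
  { pose proof (Cmod_ge_0 W).
    specialize (Hw 1%nat 0%nat); specialize (Hphi 1%nat).
    pose proof (Cmod_ge_0 (w 1%nat 0%nat)).
    specialize (Hw ltac:(lia)); lra. }
  assert (Hd : Ccv (fun m => Cpsum (d m) (phi m)) (0 : C)).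
  { intros eps Heps.
    destruct (geometric_tail_lt (K * (M + Cmod W)) r (eps / 2) Hr ltac:(lra)) as [N HN].
    assert (Hhead : Ccv (fun m => Cpsum (d m) N) (Cpsum (fun k => u k * (W - W)) N)).
    { apply Ccv_Cpsum; intros k; unfold d.
      apply Ccv_mult; [apply Ccv_const|].
      exact (Ccv_plus _ _ _ _ (Hcv k) (Ccv_const _)). }
    destruct (Hhead (eps / 2)%R ltac:(lra)) as [N' HN'].
    exists (max N N'); intros m Hm.
    specialize (HN' m ltac:(lia)); pose proof (Hphi m) as Hp.
    rewrite Cnorm_Cmod in HN' |- *.
    assert (Z : @eq C (Cpsum (fun k => u k * (W - W)) N) (0 : C)).
    { rewrite (Cpsum_ext _ (fun k => 0 * u k)) by (intros; Cring).
      rewrite Cpsum_scal; Cring. }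
    rewrite Z in HN'.
    change (Csub (Cpsum (d m) N) (0 : C)) with (Cpsum (d m) N - 0) in HN'.
    change (Csub (Cpsum (d m) (phi m)) (0 : C)) with (Cpsum (d m) (phi m) - 0).
    replace (phi m) with (N + (phi m - N))%nat by lia.
    rewrite Cpsum_add.
    replace (Cpsum (d m) N + Cpsum (fun k => d m (N + k)%nat) (phi m - N) - 0)
      with ((Cpsum (d m) N - 0) + Cpsum (fun k => d m (N + k)%nat) (phi m - N)) by Cring.
    eapply Rle_lt_trans; [apply Cmod_triangle|].
    enough (Cmod (Cpsum (fun k => d m (N + k)%nat) (phi m - N))
              <= K * (M + Cmod W) * r ^ N / (1 - r))%R by lra.
    apply Cmod_Cpsum_geometric; [exact Hr|now apply Rmult_le_pos|].
    intros k Hk; unfold d; rewrite Cmod_mult.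
    replace (K * (M + Cmod W) * r ^ (N + k))%R
      with ((K * r ^ (N + k)) * (M + Cmod W))%R by ring.
    apply Rmult_le_compat; try apply Cmod_ge_0; [apply Hu|].
    eapply Rle_trans; [apply Cmod_triangle|]; rewrite Cmod_opp.
    apply Rplus_le_compat_r, Hw; lia. }
  replace (U * W) with (0 + U * W) by Cring.
  apply (Ccv_ext (fun m => Cpsum (d m) (phi m) + Cpsum u (phi m) * W)).
  - intros m; rewrite (Cmult_comm _ W), <- Cpsum_scal, <- Cpsum_plus.
    apply Cpsum_ext; intros k _; unfold d; Cring.
  - apply Ccv_plus; [exact Hd|]; apply Ccv_mult; [exact HUphi|apply Ccv_const].
Qed.

(** * q-Pochhammer symbols *)

Lemma qpoch_S (a p : C) (n : nat) :
  qpoch a p (S n) = qpoch a p n * (1 - a * p ^ n).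
Proof.
  simpl; rewrite Cpow_Coquelicot; reflexivity.
Qed.

(** By 1 + x <= exp x, the factors contribute at most exp (c (1 + r + r^2 + ...)). This serves both
    for q-Pochhammer symbols and for their inverses. *)
Lemma perturbed_product_bound (u : nat -> R) (c r : R) :
  (0 <= r < 1)%R -> (0 <= c)%R -> (forall n, (0 <= u n)%R) -> u 0%nat = 1%R ->
  (forall n, (u (S n) <= u n * (1 + c * r ^ n))%R) ->
  forall n, (u n <= exp (c / (1 - r)))%R.
Proof.
  intros Hr Hc Hu H0 HS n.
  assert (Hrn : forall k, (0 <= r ^ k)%R) by (intros; apply pow_le; lra).
  assert (E : (u n <= exp (c * (1 - r ^ n) / (1 - r)))%R).
  { induction n as [|n IH].
    - rewrite H0; simpl; replace (c * (1 - 1) / (1 - r))%R with 0%R by (field; lra).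
      rewrite exp_0; lra.
    - eapply Rle_trans; [apply HS|].
      replace (c * (1 - r ^ S n) / (1 - r))%R
        with (c * (1 - r ^ n) / (1 - r) + c * r ^ n)%R by (simpl; field; lra).
      rewrite exp_plus; apply Rmult_le_compat; [apply Hu| |exact IH|apply exp_ineq1_le].
      specialize (Hrn n); nra. }
  eapply Rle_trans; [exact E|].
  (* Weak monotonicity of [exp], obtained by contradiction from the strict form. *)
  apply Rnot_lt_le; intros Q; apply exp_lt_inv in Q; revert Q; apply Rle_not_lt.
  unfold Rdiv; apply Rmult_le_compat_r.
  - left; apply Rinv_0_lt_compat; lra.
  - specialize (Hrn n); nra.
Qed.

Lemma qpoch_bound (a p : C) :
  (Cmod p < 1)%R -> exists M, forall n, (Cmod (qpoch a p n) <= M)%R.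
Proof.
  intros Hp; pose proof (Cmod_ge_0 p).
  exists (exp (Cmod a / (1 - Cmod p))).
  apply perturbed_product_bound; try lra.
  - apply Cmod_ge_0.
  - intros; apply Cmod_ge_0.
  - exact Cmod_1.
  - intros n; rewrite qpoch_S, Cmod_mult; apply Rmult_le_compat_l; [apply Cmod_ge_0|].
    eapply Rle_trans; [apply Cmod_triangle|].
    rewrite Cmod_opp, Cmod_mult, Cmod_pow, Cmod_1; lra.
Qed.

Lemma Cmod_pow_le_1 (z : C) (n : nat) : (Cmod z <= 1)%R -> (Cmod (z ^ n) <= 1)%R.
Proof.
  intros Hz; rewrite Cmod_pow, <- (pow1 n); apply pow_incr; split; [apply Cmod_ge_0|exact Hz].
Qed.

Lemma qpoch_factor_bound (a p : C) (n : nat) :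
  (Cmod a < 1)%R -> (Cmod p < 1)%R ->
  (1 - Cmod a * Cmod p ^ n <= Cmod (1 - a * p ^ n))%R.
Proof.
  intros Ha Hp.
  pose proof (Cmod_triangle (1 - a * p ^ n) (a * p ^ n)) as T.
  replace (1 - a * p ^ n + a * p ^ n) with (1 : C) in T by ring.
  rewrite Cmod_1, Cmod_mult, Cmod_pow in T; lra.
Qed.

Lemma qpoch_factor_neq_0 (a p : C) (n : nat) :
  (Cmod a < 1)%R -> (Cmod p < 1)%R -> 1 - a * p ^ n <> 0.
Proof.
  intros Ha Hp E; pose proof (qpoch_factor_bound a p n Ha Hp) as B.
  rewrite E, Cmod_0 in B.
  pose proof (Cmod_pow_le_1 p n (Rlt_le _ _ Hp)) as Hpn; rewrite Cmod_pow in Hpn.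
  pose proof (Cmod_ge_0 a).
  assert (0 <= Cmod p ^ n)%R by apply pow_le, Cmod_ge_0; nra.
Qed.

Lemma qpoch_neq_0 (a p : C) (n : nat) :
  (Cmod a < 1)%R -> (Cmod p < 1)%R -> qpoch a p n <> (0 : C).
Proof.
  intros Ha Hp; induction n as [|n IH].
  - change (qpoch a p 0) with (Complex.RtoC 1); intros E.
    apply RtoC_inj in E; lra.
  - rewrite qpoch_S; apply Cmult_neq_0; [exact IH|now apply qpoch_factor_neq_0].
Qed.

(** With x = |p|^n, the inverse of a factor has modulus at most 1/(1 - |a| x) <= 1 + |a| x/(1 -
    |a|), so the product estimate applies with c = |a|/(1 - |a|). *)
Lemma qpoch_inv_bound (a p : C) :
  (Cmod a < 1)%R -> (Cmod p < 1)%R ->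
  exists M, forall n, (Cmod (/ qpoch a p n) <= M)%R.
Proof.
  intros Ha Hp; pose proof (Cmod_ge_0 p); pose proof (Cmod_ge_0 a).
  exists (exp (Cmod a / (1 - Cmod a) / (1 - Cmod p))).
  apply perturbed_product_bound; try lra.
  - apply Rdiv_le_0_compat; lra.
  - intros; apply Cmod_ge_0.
  - change (qpoch a p 0) with (Complex.RtoC 1).
    rewrite Cmod_inv, Cmod_1; [apply Rinv_1|]; intros E; apply RtoC_inj in E; lra.
  - intros n; rewrite qpoch_S.
    pose proof (qpoch_factor_neq_0 a p n Ha Hp) as Hf.
    pose proof (qpoch_neq_0 a p n Ha Hp) as Hq.
    replace (/ (qpoch a p n * (1 - a * p ^ n)))
      with (/ qpoch a p n * / (1 - a * p ^ n)) by (field; split; assumption).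
    rewrite Cmod_mult; apply Rmult_le_compat_l; [apply Cmod_ge_0|].
    rewrite Cmod_inv by exact Hf.
    pose proof (qpoch_factor_bound a p n Ha Hp) as B.
    pose proof (Cmod_pow_le_1 p n (Rlt_le _ _ Hp)) as Hpn; rewrite Cmod_pow in Hpn.
    assert (0 <= Cmod p ^ n)%R by (apply pow_le; lra).
    set (x := (Cmod p ^ n)%R) in *.
    assert (Hx : (1 - Cmod a <= 1 - Cmod a * x)%R) by nra.
    eapply Rle_trans; [apply Rinv_le_contravar; [|exact B]; lra|].
    apply Rminus_le_0.
    replace (1 + Cmod a / (1 - Cmod a) * x - / (1 - Cmod a * x))%R
      with (Cmod a ^ 2 * (x * (1 - x)) / ((1 - Cmod a) * (1 - Cmod a * x)))%R
      by (field; lra).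
    apply Rdiv_le_0_compat; [|apply Rmult_lt_0_compat; lra].
    apply Rmult_le_pos; [apply pow2_ge_0|nra].
Qed.

(** Consecutive products differ by -(a;p)_n a p^n, so each product is 1 plus a partial sum of a
    geometrically dominated series. *)
Lemma qpoch_cv (a p : C) : (Cmod p < 1)%R -> exists L, qpoch_inf a p L.
Proof.
  intros Hp; destruct (qpoch_bound a p Hp) as [M HM]; pose proof (Cmod_ge_0 p).
  destruct (Cseries_geometric_bound (fun n => - (qpoch a p n * a * p ^ n))
              (M * Cmod a) (Cmod p)) as [L HL].
  - lra.
  - intros n; rewrite Cmod_opp, !Cmod_mult, Cmod_pow.
    apply Rmult_le_compat_r; [apply pow_le; lra|].
    apply Rmult_le_compat_r; [apply Cmod_ge_0|apply HM].
  - exists (1 + L).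
    apply (Ccv_ext (fun n => 1 + Cpsum (fun n => - (qpoch a p n * a * p ^ n)) n)).
    + intros n; induction n as [|n IH].
      * rewrite Cpsum_0; change (qpoch a p 0) with (Complex.RtoC 1); Cring.
      * rewrite Cpsum_S, qpoch_S, Cplus_assoc, IH; Cring.
    + apply Ccv_plus; [apply Ccv_const|exact HL].
Qed.

(** Bounded inverses keep |u n| at or above 1/M, so the limit cannot be 0. Infinite products are
    shown not to vanish in this way. *)
Lemma Ccv_neq_0 (u : nat -> C) (l : C) (M : R) :
  (forall n, u n <> 0) -> (forall n, (Cmod (/ u n) <= M)%R) -> Ccv u l -> l <> 0.
Proof.
  intros Hu HM H E; subst l.
  assert (M0 : (0 < M)%R).
  { eapply Rlt_le_trans; [|apply (HM 0%nat)].
    rewrite Cmod_inv by apply Hu; apply Rinv_0_lt_compat, Cmod_gt_0, Hu. }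
  destruct (H (/ M)%R (Rinv_0_lt_compat _ M0)) as [N HN].
  specialize (HN N (Nat.le_refl N)); rewrite Cnorm_Cmod in HN.
  change (Csub (u N) (0 : C)) with (u N - 0) in HN.
  replace (u N - 0) with (u N) in HN by ring.
  specialize (HM N); rewrite Cmod_inv in HM by apply Hu.
  assert (P : (0 < Cmod (u N))%R) by apply Cmod_gt_0, Hu.
  apply Rinv_lt_contravar in HN; [|apply Rmult_lt_0_compat; [exact P|now apply Rinv_0_lt_compat]].
  rewrite Rinv_inv in HN; lra.
Qed.

Lemma qpoch_inf_neq_0 (a p L : C) :
  (Cmod a < 1)%R -> (Cmod p < 1)%R -> qpoch_inf a p L -> L <> 0.
Proof.
  intros Ha Hp H; destruct (qpoch_inv_bound a p Ha Hp) as [M HM].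
  apply (Ccv_neq_0 (qpoch a p) L M); [|exact HM|exact H].
  intros n; now apply qpoch_neq_0.
Qed.

(** * The finite form of the bilateral identity *)

Definition PA (q : C) (n : nat) : C := qpoch (q ^ 2) (q ^ 2) n.
Definition PC (q : C) (n : nat) : C := qpoch (- q) (q ^ 2) n.
Definition PD (q : C) (n : nat) : C := qpoch (- q ^ 2) (q ^ 2) n.
(** [PE] and [PF] are the products in the mock theta summands taken at q^2; the base is written
    (q^2)^2 to agree with those summands after substitution. *)
Definition PE (q : C) (n : nat) : C := qpoch (- q ^ 2) ((q ^ 2) ^ 2) n.
Definition PF (q : C) (n : nat) : C := qpoch (- (q ^ 2) ^ 2) ((q ^ 2) ^ 2) n.

Lemma PA_S (q : C) n : PA q (S n) = PA q n * (1 - q ^ 2 * (q ^ 2) ^ n).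
Proof. exact (qpoch_S _ _ _). Qed.

Lemma PC_S (q : C) n : PC q (S n) = PC q n * (1 + q * (q ^ 2) ^ n).
Proof. unfold PC; rewrite qpoch_S; ring. Qed.

Lemma PD_S (q : C) n : PD q (S n) = PD q n * (1 + q ^ 2 * (q ^ 2) ^ n).
Proof. unfold PD; rewrite qpoch_S; ring. Qed.

Lemma Cpow_sqr_comm (z : C) (n : nat) : (z ^ 2) ^ n = (z ^ n) ^ 2.
Proof. now rewrite <- !Cpow_mult_r, Nat.mul_comm. Qed.

(** The new factor is expressed through (q^2)^n alone, which then acts as a single variable for
    [ring] and [field]. *)
Lemma PE_S (q : C) n : PE q (S n) = PE q n * (1 + q ^ 2 * ((q ^ 2) ^ n) ^ 2).
Proof.
  unfold PE; rewrite qpoch_S, (Cpow_sqr_comm (q ^ 2)); ring.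
Qed.

Lemma PF_S (q : C) n : PF q (S n) = PF q n * (1 + q ^ 4 * ((q ^ 2) ^ n) ^ 2).
Proof.
  unfold PF; rewrite qpoch_S, (Cpow_sqr_comm (q ^ 2)); ring.
Qed.

Lemma Cmod_pow_lt_1 (z : C) (n : nat) : (Cmod z < 1)%R -> (Cmod (z ^ S n) < 1)%R.
Proof.
  intros Hz; pose proof (Cmod_pow_le_1 z n (Rlt_le _ _ Hz)).
  rewrite Cpow_S, Cmod_mult; pose proof (Cmod_ge_0 z); nra.
Qed.

Ltac Cmod_lt_1 :=
  rewrite ?Cmod_opp; repeat apply Cmod_pow_lt_1; rewrite ?Cmod_opp; assumption.

Lemma PA_neq_0 (q : C) n : (Cmod q < 1)%R -> PA q n <> 0.
Proof. intros Hq; apply qpoch_neq_0; Cmod_lt_1. Qed.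

Lemma PC_neq_0 (q : C) n : (Cmod q < 1)%R -> PC q n <> 0.
Proof. intros Hq; apply qpoch_neq_0; Cmod_lt_1. Qed.

Lemma PD_neq_0 (q : C) n : (Cmod q < 1)%R -> PD q n <> 0.
Proof. intros Hq; apply qpoch_neq_0; Cmod_lt_1. Qed.

Lemma PE_neq_0 (q : C) n : (Cmod q < 1)%R -> PE q n <> 0.
Proof. intros Hq; apply qpoch_neq_0; Cmod_lt_1. Qed.

Lemma PF_neq_0 (q : C) n : (Cmod q < 1)%R -> PF q n <> 0.
Proof. intros Hq; apply qpoch_neq_0; Cmod_lt_1. Qed.

(* The common shape of the two telescoping steps below, with denominators cleared: [x1], ..,
   [x4] are the factors by which the four q-products of the weight grow from [m] to [m + 1],
   and [r / N] is the growth factor of the closed form. *)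
Lemma wz_step_of_polynomial_identity (E s f g N r a a' c c' x1 x2 x3 x4 h h' : C) :
  N <> 0 -> a <> 0 -> a' <> 0 -> c <> 0 -> c' <> 0 ->
  x1 <> 0 -> x2 <> 0 -> x3 <> 0 -> x4 <> 0 ->
  s * (N - r * (x1 * x2 * x3 * x4)) = h' * g * (x1 * x3) - h * f * (x2 * x4) ->
  E * s / (a * x1 * (a' * x2) * (c * x3) * (c' * x4))
    - r / N * (E * s / (a * a' * c * c'))
  = E * g * h' / (N * (a * (a' * x2) * c * (c' * x4)))
    - E * f * h / (N * (a * x1 * a' * (c * x3) * c')).
Proof.
  intros HN Ha Ha' Hc Hc' H1 H2 H3 H4 K.
  apply Ceq_minus.
  replace (_ - _) with
    (E / (N * a * a' * c * c' * (x1 * x2 * x3 * x4)) *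
     (s * (N - r * (x1 * x2 * x3 * x4)) - (h' * g * (x1 * x3) - h * f * (x2 * x4)))).
  - rewrite K; unfold Cminus; rewrite Cplus_opp_r; ring.
  - field; repeat split; assumption.
Qed.

(* The summand of the bilateral series at [n >= 0] is [pos_term q n], at [n = - (j + 1)] it is
   [neg_term q j]. In [pos_summand] and [neg_summand], it carries the weight
   [1 / ((q^2;q^2)_(m-n) (q^2;q^2)_(m+n) (-q;q^2)_(m-n) (-q;q^2)_(m+n+1))], with [m = n + e] and
   [m = j + 1 + e] respectively, so that no truncated subtraction occurs. *)
Definition pos_term (q : C) (n : nat) : C :=
  (q ^ 2) ^ (n * n) * PE q n / PF q n * (1 + q * ((q ^ 2) ^ n) ^ 2).

Definition neg_term (q : C) (j : nat) : C :=
  2 * (q ^ 2) ^ (j * (j + 1)) * PF q j / PE q (S j) * (q * (1 + q ^ 3 * ((q ^ 2) ^ j) ^ 2)).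

Definition pos_summand (q : C) (n e : nat) : C :=
  pos_term q n / (PA q e * PA q (e + 2 * n) * PC q e * PC q (S (e + 2 * n))).

Definition neg_summand (q : C) (j e : nat) : C :=
  neg_term q j / (PA q e * PA q (S (S (e + 2 * j))) * PC q (S e) * PC q (S (S (e + 2 * j)))).

(** With X = q^(2m), [wz_num / wz_den] is the growth of the closed form C_(2m) / (A_(2m) D_(2m))
    from m to m + 1. *)
Definition wz_den (q X : C) : C := (1 - q ^ 4 * X ^ 4) * (1 - q ^ 8 * X ^ 4).
Definition wz_num (q X : C) : C := (1 + q * X ^ 2) * (1 + q ^ 3 * X ^ 2).

(* The Wilf-Zeilberger certificate at [n >= 0] with [m = n + e], and at [- j] with [m = j + e].
   It was found by solving for a Laurent polynomial factor of degrees -2 to 0 in [q^(2n)]. *)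
Definition pos_cert (q : C) (n e : nat) : C :=
  let Z := (q ^ 2) ^ e in
  let X := (q ^ 2) ^ n * Z in
  (q ^ 2) ^ (n * n) * PE q n / PF q n * (1 + ((q ^ 2) ^ n) ^ 2) *
  (q ^ 2 * X ^ 2 * (1 + q ^ 3 * X ^ 2) + (1 - q) * q * Z * (1 + q ^ 5 * X ^ 4)
   - q ^ 3 * Z ^ 2 * (1 + q ^ 3 * X ^ 2)) /
  (wz_den q X * (PA q (S e) * PA q (e + 2 * n) * PC q (S e) * PC q (S (e + 2 * n)))).

Definition neg_cert (q : C) (j e : nat) : C :=
  let Z := (q ^ 2) ^ e in
  let X := (q ^ 2) ^ j * Z in
  2 * (q ^ 2) ^ (j * (j + 1)) * PF q j / PE q j *
  (q ^ 2 * Z ^ 2 * (1 + q ^ 3 * X ^ 2) + (1 - q) * q * Z * (1 + q ^ 5 * X ^ 4)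
   - q ^ 3 * X ^ 2 * (1 + q ^ 3 * X ^ 2)) /
  (wz_den q X * (PA q e * PA q (S (e + 2 * j)) * PC q (S e) * PC q (S (e + 2 * j)))).

(** * Nonvanishing of the factors in the denominators *)

Lemma one_minus_neq_0 (z : C) : (Cmod z < 1)%R -> 1 - z <> 0.
Proof.
  intros Hz E; apply Ceq_minus in E; rewrite <- E, Cmod_1 in Hz; lra.
Qed.

Lemma one_plus_neq_0 (z : C) : (Cmod z < 1)%R -> 1 + z <> 0.
Proof.
  intros Hz; replace (1 + z) with (1 - - z) by ring.
  apply one_minus_neq_0; now rewrite Cmod_opp.
Qed.

Lemma Cmod_pow_mult_lt_1 (q z : C) (k : nat) :
  (Cmod q < 1)%R -> (Cmod z <= 1)%R -> (Cmod (q ^ S k * z) < 1)%R.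
Proof.
  intros Hq Hz; pose proof (Cmod_pow_lt_1 q k Hq).
  rewrite Cmod_mult; pose proof (Cmod_ge_0 (q ^ S k)); pose proof (Cmod_ge_0 z); nra.
Qed.

Lemma Cmod_q2_pow_le_1 (q : C) (n : nat) : (Cmod q < 1)%R -> (Cmod ((q ^ 2) ^ n) <= 1)%R.
Proof.
  intros Hq; apply Cmod_pow_le_1, Rlt_le, Cmod_pow_lt_1, Hq.
Qed.

Ltac neq_0_by q k w :=
  first [apply one_minus_neq_0 | apply one_plus_neq_0];
  lazymatch goal with |- (Cmod ?z < 1)%R => replace z with (q ^ S k * w) by ring end;
  apply Cmod_pow_mult_lt_1; assumption.

(** The candidates are the factors that [field] leaves in the boundary cases of the telescoping and
    in the induction for the closed form. *)
Ltac neq_0_search q X :=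
  first [neq_0_by q 0%nat (1 : C) | neq_0_by q 1%nat (1 : C)
    | neq_0_by q 0%nat (X ^ 2) | neq_0_by q 1%nat (X ^ 2) | neq_0_by q 2%nat (X ^ 2)
    | neq_0_by q 3%nat (X ^ 2) | neq_0_by q 4%nat (X ^ 2)
    | neq_0_by q 3%nat (X ^ 4) | neq_0_by q 7%nat (X ^ 4)].

Lemma wz_den_neq_0 (q X : C) : (Cmod q < 1)%R -> (Cmod X <= 1)%R -> wz_den q X <> 0.
Proof.
  intros Hq HX.
  assert (HX4 : (Cmod (X ^ 4) <= 1)%R) by now apply Cmod_pow_le_1.
  apply Cmult_neq_0; apply one_minus_neq_0, Cmod_pow_mult_lt_1; assumption.
Qed.

Lemma PA_ratio_neq_0 (q : C) (n : nat) : (Cmod q < 1)%R -> 1 - q ^ 2 * (q ^ 2) ^ n <> 0.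
Proof.
  intros Hq; apply one_minus_neq_0, Cmod_pow_mult_lt_1, Cmod_q2_pow_le_1; assumption.
Qed.

Lemma PC_ratio_neq_0 (q : C) (n : nat) : (Cmod q < 1)%R -> 1 + q * (q ^ 2) ^ n <> 0.
Proof.
  intros Hq; apply one_plus_neq_0; rewrite <- (Cpow_1_r q) at 1.
  apply Cmod_pow_mult_lt_1, Cmod_q2_pow_le_1; assumption.
Qed.

(** Here [m = n + S d]. Once common factors are cleared, the claim is a polynomial identity in q, Y
    = q^(2n) and Z = q^(2d). *)
Lemma pos_cert_step (q : C) (n d : nat) :
  (Cmod q < 1)%R ->
  let X := (q ^ 2) ^ (n + S d) in
  pos_summand q n (S (S d)) - wz_num q X / wz_den q X * pos_summand q n (S d)
  = pos_cert q (S n) d - pos_cert q n (S d).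
Proof.
  intros Hq X.
  set (Y := (q ^ 2) ^ n); set (Z := (q ^ 2) ^ d).
  assert (EX : X = q ^ 2 * Y * Z) by (unfold X, Y, Z; rewrite Cpow_add_r, (Cpow_S (q ^ 2)); ring).
  assert (HX : (Cmod X <= 1)%R) by apply Cmod_q2_pow_le_1, Hq.
  (* The fourth argument is the prefactor of the certificate at n + 1 relative to [E]: its factor 1
     + q^4 Y^2 has cancelled against the new factor of [PF]. *)
  pose proof (wz_step_of_polynomial_identity ((q ^ 2) ^ (n * n) * PE q n / PF q n)
    (1 + q * Y ^ 2) (1 + Y ^ 2) (q ^ 2 * Y ^ 2 * (1 + q ^ 2 * Y ^ 2))
    (wz_den q X) (wz_num q X)
    (PA q (S d)) (PA q (S d + 2 * n)) (PC q (S d)) (PC q (S (S d + 2 * n)))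
    (1 - q ^ 2 * (q ^ 2) ^ S d) (1 - q ^ 2 * (q ^ 2) ^ (S d + 2 * n))
    (1 + q * (q ^ 2) ^ S d) (1 + q * (q ^ 2) ^ S (S d + 2 * n))
    (q ^ 2 * X ^ 2 * (1 + q ^ 3 * X ^ 2) + (1 - q) * q * (q ^ 2 * Z) * (1 + q ^ 5 * X ^ 4)
      - q ^ 3 * (q ^ 2 * Z) ^ 2 * (1 + q ^ 3 * X ^ 2))
    (q ^ 2 * X ^ 2 * (1 + q ^ 3 * X ^ 2) + (1 - q) * q * Z * (1 + q ^ 5 * X ^ 4)
      - q ^ 3 * Z ^ 2 * (1 + q ^ 3 * X ^ 2))) as K.
  rewrite <- !PA_S, <- !PC_S in K.
  specialize (K (wz_den_neq_0 _ _ Hq HX) (PA_neq_0 _ _ Hq) (PA_neq_0 _ _ Hq)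
    (PC_neq_0 _ _ Hq) (PC_neq_0 _ _ Hq) (PA_ratio_neq_0 _ _ Hq) (PA_ratio_neq_0 _ _ Hq)
    (PC_ratio_neq_0 _ _ Hq) (PC_ratio_neq_0 _ _ Hq)).
  unfold pos_summand, pos_term, pos_cert.
  fold Y Z.
  replace ((q ^ 2) ^ S n) with (q ^ 2 * Y) by (unfold Y; now rewrite (Cpow_S (q ^ 2))).
  replace ((q ^ 2) ^ S d) with (q ^ 2 * Z) by (unfold Z; now rewrite (Cpow_S (q ^ 2))).
  replace (q ^ 2 * Y * Z) with X by exact EX.
  replace (Y * (q ^ 2 * Z)) with X by (rewrite EX; ring).
  replace ((q ^ 2) ^ (S n * S n)) with ((q ^ 2) ^ (n * n) * (q ^ 2 * Y ^ 2))
    by (replace (S n * S n)%nat with (n * n + n + n + 1)%nat by lia;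
        unfold Y; rewrite !Cpow_add_r; ring).
  replace (d + 2 * S n)%nat with (S (S d + 2 * n)) by lia.
  change (S (S d) + 2 * n)%nat with (S (S d + 2 * n)).
  assert (HF : 1 + q ^ 4 * Y ^ 2 <> 0).
  { apply one_plus_neq_0, Cmod_pow_mult_lt_1; [exact Hq|].
    unfold Y; rewrite <- Cpow_mult_r; apply Cmod_q2_pow_le_1, Hq. }
  match type of K with ?P -> _ => assert (HP : P) end.
  { rewrite !(Cpow_S (q ^ 2)), !Cpow_add_r, (Cpow_S (q ^ 2)), (Nat.mul_comm 2 n), Cpow_mult_r.
    fold Y Z; unfold wz_den, wz_num; rewrite EX; ring. }
  rewrite (K HP), PE_S, PF_S; fold Y.
  do 3 f_equal.
  field; split; [exact HF|now apply PF_neq_0].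
Qed.

Lemma neg_cert_step (q : C) (j d : nat) :
  (Cmod q < 1)%R ->
  let X := (q ^ 2) ^ (j + S d) in
  neg_summand q j (S d) - wz_num q X / wz_den q X * neg_summand q j d
  = neg_cert q j (S d) - neg_cert q (S j) d.
Proof.
  intros Hq X.
  set (Y := (q ^ 2) ^ j); set (Z := (q ^ 2) ^ d).
  assert (EX : X = q ^ 2 * Y * Z)
    by (unfold X, Y, Z; rewrite Cpow_add_r, (Cpow_S (q ^ 2)); ring).
  assert (HX : (Cmod X <= 1)%R) by apply Cmod_q2_pow_le_1, Hq.
  (* The last two arguments carry a minus sign because n = -j decreases as j grows. The third one
     removes the last factor of [PE q (S j)]. *)
  pose proof (wz_step_of_polynomial_identity
    (2 * (q ^ 2) ^ (j * (j + 1)) * PF q j / PE q (S j))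
    (q * (1 + q ^ 3 * Y ^ 2)) (1 + q ^ 2 * Y ^ 2) (q ^ 4 * Y ^ 2 * (1 + q ^ 4 * Y ^ 2))
    (wz_den q X) (wz_num q X)
    (PA q d) (PA q (S (S d + 2 * j))) (PC q (S d)) (PC q (S (S d + 2 * j)))
    (1 - q ^ 2 * (q ^ 2) ^ d) (1 - q ^ 2 * (q ^ 2) ^ S (S d + 2 * j))
    (1 + q * (q ^ 2) ^ S d) (1 + q * (q ^ 2) ^ S (S d + 2 * j))
    (- (q ^ 2 * (q ^ 2 * Z) ^ 2 * (1 + q ^ 3 * X ^ 2)
        + (1 - q) * q * (q ^ 2 * Z) * (1 + q ^ 5 * X ^ 4)
        - q ^ 3 * X ^ 2 * (1 + q ^ 3 * X ^ 2)))
    (- (q ^ 2 * Z ^ 2 * (1 + q ^ 3 * X ^ 2) + (1 - q) * q * Z * (1 + q ^ 5 * X ^ 4)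
        - q ^ 3 * X ^ 2 * (1 + q ^ 3 * X ^ 2)))) as K.
  rewrite <- !PA_S, <- !PC_S in K.
  specialize (K (wz_den_neq_0 _ _ Hq HX) (PA_neq_0 _ _ Hq) (PA_neq_0 _ _ Hq)
    (PC_neq_0 _ _ Hq) (PC_neq_0 _ _ Hq) (PA_ratio_neq_0 _ _ Hq) (PA_ratio_neq_0 _ _ Hq)
    (PC_ratio_neq_0 _ _ Hq) (PC_ratio_neq_0 _ _ Hq)).
  unfold neg_summand, neg_term, neg_cert.
  fold Y Z.
  replace ((q ^ 2) ^ S j) with (q ^ 2 * Y) by (unfold Y; now rewrite (Cpow_S (q ^ 2))).
  replace ((q ^ 2) ^ S d) with (q ^ 2 * Z) by (unfold Z; now rewrite (Cpow_S (q ^ 2))).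
  replace (q ^ 2 * Y * Z) with X by exact EX.
  replace (Y * (q ^ 2 * Z)) with X by (rewrite EX; ring).
  replace ((q ^ 2) ^ (S j * (S j + 1))) with ((q ^ 2) ^ (j * (j + 1)) * (q ^ 4 * Y ^ 2))
    by (replace (S j * (S j + 1))%nat with (j * (j + 1) + j + j + 2)%nat by lia;
        unfold Y; rewrite !(Cpow_add_r (q ^ 2)); ring).
  replace (d + 2 * S j)%nat with (S (S d + 2 * j)) by lia.
  change (S (d + 2 * j)) with (S d + 2 * j)%nat.
  assert (HE : 1 + q ^ 2 * Y ^ 2 <> 0).
  { apply one_plus_neq_0, Cmod_pow_mult_lt_1; [exact Hq|].
    unfold Y; rewrite <- Cpow_mult_r; apply Cmod_q2_pow_le_1, Hq. }
  match type of K with ?P -> _ => assert (HP : P) end.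
  { rewrite !(Cpow_S (q ^ 2)), !Cpow_add_r, (Cpow_S (q ^ 2)), (Nat.mul_comm 2 j), Cpow_mult_r.
    fold Y Z; unfold wz_den, wz_num; rewrite EX; ring. }
  etransitivity; [exact (K HP)|].
  rewrite PE_S, PF_S; fold Y.
  pose proof (PE_neq_0 q j Hq).
  assert (1 + (q * Y) ^ 2 <> 0) by (replace ((q * Y) ^ 2) with (q ^ 2 * Y ^ 2) by ring; exact HE).
  field; repeat split; auto using PA_neq_0, PC_neq_0, wz_den_neq_0.
Qed.

(** The steps n = m and n = m + 1 taken together: the certificate at m + 1, where e would be -1,
    cancels between them, and the one at m + 2 is formally 0, since 1/(q^2;q^2)_(-1) = 0. *)
Lemma pos_cert_last (q : C) (m : nat) :
  (Cmod q < 1)%R ->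
  let X := (q ^ 2) ^ m in
  pos_summand q m 1 + pos_summand q (S m) 0 - wz_num q X / wz_den q X * pos_summand q m 0
  = - pos_cert q m 0.
Proof.
  intros Hq X.
  unfold pos_summand, pos_term, pos_cert.
  fold X.
  replace ((q ^ 2) ^ S m) with (q ^ 2 * X) by (unfold X; now rewrite (Cpow_S (q ^ 2))).
  replace ((q ^ 2) ^ (S m * S m)) with ((q ^ 2) ^ (m * m) * (q ^ 2 * X ^ 2))
    by (replace (S m * S m)%nat with (m * m + m + m + 1)%nat by lia;
        unfold X; rewrite !Cpow_add_r; ring).
  replace (0 + 2 * S m)%nat with (S (S (2 * m))) by lia.
  change (1 + 2 * m)%nat with (S (2 * m)); change (0 + 2 * m)%nat with (2 * m)%nat.
  rewrite !PE_S, !PF_S, !PA_S, !PC_S.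
  rewrite !(Cpow_S (q ^ 2)), !(Nat.mul_comm 2 m), !Cpow_mult_r.
  fold X.
  change (PA q 0) with (Complex.RtoC 1); change (PC q 0) with (Complex.RtoC 1).
  change ((q ^ 2) ^ 0) with (Complex.RtoC 1); unfold wz_den, wz_num.
  assert (HX : (Cmod X <= 1)%R) by apply Cmod_q2_pow_le_1, Hq.
  assert (HX2 : (Cmod (X ^ 2) <= 1)%R) by now apply Cmod_pow_le_1.
  assert (HX4 : (Cmod (X ^ 4) <= 1)%R) by now apply Cmod_pow_le_1.
  assert (H1 : (Cmod 1 <= 1)%R) by (rewrite Cmod_1; lra).
  field; repeat split; try solve [now apply PA_neq_0 | now apply PC_neq_0 | now apply PF_neq_0].
  all: neq_0_search q X.
Qed.

(** The step n = -(m + 1): this term is present only in the sum for m + 1, and the certificate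
    beyond it is formally 0. *)
Lemma neg_cert_last (q : C) (m : nat) :
  (Cmod q < 1)%R -> neg_summand q m 0 = neg_cert q m 0.
Proof.
  intros Hq.
  unfold neg_summand, neg_term, neg_cert.
  set (X := (q ^ 2) ^ m).
  change ((q ^ 2) ^ 0) with (Complex.RtoC 1).
  change (0 + 2 * m)%nat with (2 * m)%nat.
  rewrite !PE_S, !PA_S, !PC_S.
  rewrite !(Cpow_S (q ^ 2)), !(Nat.mul_comm 2 m), !Cpow_mult_r.
  fold X; rewrite Cmult_1_r.
  change (PA q 0) with (Complex.RtoC 1); change (PC q 0) with (Complex.RtoC 1).
  unfold wz_den.
  assert (HX : (Cmod X <= 1)%R) by apply Cmod_q2_pow_le_1, Hq.
  assert (HX2 : (Cmod (X ^ 2) <= 1)%R) by now apply Cmod_pow_le_1.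
  assert (HX4 : (Cmod (X ^ 4) <= 1)%R) by now apply Cmod_pow_le_1.
  assert (H1 : (Cmod 1 <= 1)%R) by (rewrite Cmod_1; lra).
  field; repeat split; try solve [now apply PA_neq_0 | now apply PC_neq_0 | now apply PE_neq_0].
  all: neq_0_search q X.
Qed.

(** The weighted sums over 0 <= n <= m and -m <= n <= -1; on these ranges the subtractions are
    exact. *)
Definition pos_sum (q : C) (m : nat) : C := Cpsum (fun n => pos_summand q n (m - n)) (S m).
Definition neg_sum (q : C) (m : nat) : C := Cpsum (fun j => neg_summand q j (m - S j)) m.

Lemma pos_partial_sum (q : C) (m n : nat) :
  (Cmod q < 1)%R -> (n <= m)%nat ->
  let rho := wz_num q ((q ^ 2) ^ m) / wz_den q ((q ^ 2) ^ m) in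
  Cpsum (fun k => pos_summand q k (S m - k)) n
    - rho * Cpsum (fun k => pos_summand q k (m - k)) n
  = pos_cert q n (m - n) - pos_cert q 0 m.
Proof.
  intros Hq Hn rho; induction n as [|n IH].
  - rewrite !Cpsum_0, Nat.sub_0_r; ring.
  - specialize (IH ltac:(lia)).
    pose proof (pos_cert_step q n (m - S n) Hq) as K; cbv zeta in K.
    replace (n + S (m - S n))%nat with m in K by lia; fold rho in K.
    rewrite !Cpsum_S.
    replace (S m - n)%nat with (S (S (m - S n))) by lia.
    replace (m - n)%nat with (S (m - S n)) in IH |- * by lia.
    transitivity ((pos_cert q (S n) (m - S n) - pos_cert q n (S (m - S n)))
      + (pos_cert q n (S (m - S n)) - pos_cert q 0 m)); [|ring].
    rewrite <- K, <- IH; ring.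
Qed.

Lemma neg_partial_sum (q : C) (m n : nat) :
  (Cmod q < 1)%R -> (n <= m)%nat ->
  let rho := wz_num q ((q ^ 2) ^ m) / wz_den q ((q ^ 2) ^ m) in
  Cpsum (fun k => neg_summand q k (m - k)) n
    - rho * Cpsum (fun k => neg_summand q k (m - S k)) n
  = neg_cert q 0 m - neg_cert q n (m - n).
Proof.
  intros Hq Hn rho; induction n as [|n IH].
  - rewrite !Cpsum_0, Nat.sub_0_r; ring.
  - specialize (IH ltac:(lia)).
    pose proof (neg_cert_step q n (m - S n) Hq) as K; cbv zeta in K.
    replace (n + S (m - S n))%nat with m in K by lia; fold rho in K.
    rewrite !Cpsum_S.
    replace (m - n)%nat with (S (m - S n)) in IH |- * by lia.
    transitivity ((neg_cert q n (S (m - S n)) - neg_cert q (S n) (m - S n))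
      + (neg_cert q 0 m - neg_cert q n (S (m - S n)))); [|ring].
    rewrite <- K, <- IH; ring.
Qed.

(** The two halves of the certificate meet at n = 0, so their boundary values there cancel when the
    telescoped sums are added. *)
Lemma cert_0 (q : C) (m : nat) : pos_cert q 0 m = neg_cert q 0 m.
Proof.
  unfold pos_cert, neg_cert; cbv zeta.
  replace (m + 2 * 0)%nat with m by lia; simpl (0 * _)%nat.
  change ((q ^ 2) ^ 0) with (Complex.RtoC 1); rewrite !Cmult_1_l.
  change (PE q 0) with (Complex.RtoC 1); change (PF q 0) with (Complex.RtoC 1).
  f_equal; [field|ring].
Qed.

Lemma finite_sum_S (q : C) (m : nat) :
  (Cmod q < 1)%R ->
  pos_sum q (S m) + neg_sum q (S m)
  = wz_num q ((q ^ 2) ^ m) / wz_den q ((q ^ 2) ^ m) * (pos_sum q m + neg_sum q m).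
Proof.
  intros Hq; unfold pos_sum, neg_sum.
  pose proof (pos_partial_sum q m m Hq (le_n m)) as P.
  pose proof (neg_partial_sum q m m Hq (le_n m)) as N.
  pose proof (pos_cert_last q m Hq) as PL.
  pose proof (neg_cert_last q m Hq) as NL.
  cbv zeta in P, N, PL.
  rewrite (Cpsum_S _ (S m)), !(Cpsum_S _ m), !Nat.sub_diag in *.
  replace (S m - m)%nat with 1%nat by lia.
  rewrite cert_0 in P.
  set (rho := wz_num q _ / wz_den q _) in *.
  apply Ceq_minus.
  change (fun j => neg_summand q j (S m - S j)) with (fun j => neg_summand q j (m - j)).
  (* The two telescoping ranges, followed by the boundary terms at the right end and at the left
     end. *)
  transitivity ((Cpsum (fun k => pos_summand q k (S m - k)) m
      - rho * Cpsum (fun k => pos_summand q k (m - k)) m)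
    + (Cpsum (fun k => neg_summand q k (m - k)) m
      - rho * Cpsum (fun k => neg_summand q k (m - S k)) m)
    + (pos_summand q m 1 + pos_summand q (S m) 0 - rho * pos_summand q m 0)
    + neg_summand q m 0); [ring|].
  rewrite P, N, PL, NL; ring.
Qed.

(** Both sides equal 1 at m = 0 and grow by the same ratio [wz_num / wz_den]. *)
Lemma finite_identity (q : C) (m : nat) :
  (Cmod q < 1)%R ->
  pos_sum q m + neg_sum q m = PC q (2 * m) / (PA q (2 * m) * PD q (2 * m)).
Proof.
  intros Hq; induction m as [|m IH].
  - unfold pos_sum, neg_sum; rewrite Cpsum_S, !Cpsum_0.
    unfold pos_summand, pos_term; simpl (0 - 0)%nat; simpl (0 * 0)%nat; simpl (2 * 0)%nat.
    simpl (0 + 0)%nat; rewrite PC_S.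
    change ((q ^ 2) ^ 0) with (Complex.RtoC 1).
    change (PA q 0) with (Complex.RtoC 1); change (PC q 0) with (Complex.RtoC 1).
    change (PD q 0) with (Complex.RtoC 1); change (PE q 0) with (Complex.RtoC 1).
    change (PF q 0) with (Complex.RtoC 1).
    field; apply one_plus_neq_0, Hq.
  - rewrite finite_sum_S, IH by exact Hq.
    replace (2 * S m)%nat with (S (S (2 * m))) by lia.
    rewrite !PA_S, !PC_S, !PD_S, !(Cpow_S (q ^ 2)), !(Nat.mul_comm 2 m), !Cpow_mult_r.
    set (X := (q ^ 2) ^ m).
    unfold wz_den, wz_num.
    assert (HX : (Cmod X <= 1)%R) by apply Cmod_q2_pow_le_1, Hq.
    assert (HX2 : (Cmod (X ^ 2) <= 1)%R) by now apply Cmod_pow_le_1.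
    assert (HX4 : (Cmod (X ^ 4) <= 1)%R) by now apply Cmod_pow_le_1.
    assert (H1 : (Cmod 1 <= 1)%R) by (rewrite Cmod_1; lra).
    field; repeat split; try solve [now apply PA_neq_0 | now apply PD_neq_0].
    all: neq_0_search q X.
Qed.

(** * The limit *)

(** This and the next three lemmas separate the power of q^2 from a product of two bounded factors,
    as the geometric majorant requires. *)
Lemma S0_term_q2 (q : C) (n : nat) :
  S0_term (Cpow q 2) n = (q ^ 2) ^ (n * n) * (PE q n * / PF q n).
Proof.
  unfold S0_term, PE, PF; rewrite Cdiv_Coquelicot, !Cpow_Coquelicot.
  unfold Complex.Cdiv; rewrite Cmult_assoc; reflexivity.
Qed.

Lemma S1_term_q2 (q : C) (n : nat) :
  S1_term (Cpow q 2) n = (q ^ 2) ^ (n * (n + 2)) * (PE q n * / PF q n).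
Proof.
  unfold S1_term, PE, PF; rewrite Cdiv_Coquelicot, !Cpow_Coquelicot.
  unfold Complex.Cdiv; rewrite Cmult_assoc; reflexivity.
Qed.

Lemma T0_term_q2 (q : C) (n : nat) :
  T0_term (Cpow q 2) n = (q ^ 2) ^ ((n + 1) * (n + 2)) * (PF q n * / PE q (S n)).
Proof.
  unfold T0_term, PE, PF; rewrite Cdiv_Coquelicot, !Cpow_Coquelicot.
  unfold Complex.Cdiv; rewrite Cmult_assoc; reflexivity.
Qed.

Lemma T1_term_q2 (q : C) (n : nat) :
  T1_term (Cpow q 2) n = (q ^ 2) ^ (n * (n + 1)) * (PF q n * / PE q (S n)).
Proof.
  unfold T1_term, PE, PF; rewrite Cdiv_Coquelicot, !Cpow_Coquelicot.
  unfold Complex.Cdiv; rewrite Cmult_assoc; reflexivity.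
Qed.

(** From n(n + 2) = n^2 + 2n: the S_1 summand is q^(4n) times the S_0 summand, which produces 1 +
    q^(4n+1). *)
Lemma pos_term_S0_S1 (q : C) (n : nat) :
  pos_term q n = S0_term (Cpow q 2) n + q * S1_term (Cpow q 2) n.
Proof.
  rewrite S0_term_q2, S1_term_q2; unfold pos_term, Complex.Cdiv.
  replace (n * (n + 2))%nat with (n * n + n * 2)%nat by lia.
  rewrite Cpow_add_r, (Cpow_mult_r (q ^ 2) n 2); ring.
Qed.

(** From (n + 1)(n + 2) = n(n + 1) + 2n + 2: the two powers combine to q^(4n+4) + q = q (1 +
    q^(4n+3)). *)
Lemma neg_term_T0_T1 (q : C) (n : nat) :
  neg_term q n = 2 * (T0_term (Cpow q 2) n + q * T1_term (Cpow q 2) n).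
Proof.
  rewrite T0_term_q2, T1_term_q2; unfold neg_term, Complex.Cdiv.
  replace ((n + 1) * (n + 2))%nat with (n * (n + 1) + n * 2 + 2)%nat by lia.
  rewrite !(Cpow_add_r (q ^ 2)), (Cpow_mult_r (q ^ 2) n 2); ring.
Qed.

(** The quadratic exponents are at least n, so |p|^(e n) <= |p|^n. *)
Lemma pow_times_bounded (p : C) (e : nat -> nat) (u v : nat -> C) (M N : R) :
  (Cmod p < 1)%R -> (forall n, (n <= e n)%nat) ->
  (forall n, (Cmod (u n) <= M)%R) -> (forall n, (Cmod (v n) <= N)%R) ->
  forall n, (Cmod (p ^ e n * (u n * v n)) <= M * N * Cmod p ^ n)%R.
Proof.
  intros Hp He Hu Hv n.
  rewrite !Cmod_mult, Cmod_pow, (Rmult_comm (M * N)).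
  replace (e n) with (n + (e n - n))%nat by (specialize (He n); lia).
  rewrite pow_add.
  pose proof (Cmod_pow_le_1 p (e n - n) (Rlt_le _ _ Hp)) as Hpe; rewrite Cmod_pow in Hpe.
  assert (0 <= Cmod p ^ (e n - n))%R by apply pow_le, Cmod_ge_0.
  assert (0 <= Cmod p ^ n)%R by apply pow_le, Cmod_ge_0.
  apply Rmult_le_compat; [now apply Rmult_le_pos| |nra|].
  - apply Rmult_le_pos; apply Cmod_ge_0.
  - apply Rmult_le_compat; auto using Cmod_ge_0.
Qed.

Lemma PE_PF_bounds (q : C) :
  (Cmod q < 1)%R ->
  exists M, forall n,
    (Cmod (PE q n) <= M /\ Cmod (/ PE q n) <= M /\
     Cmod (PF q n) <= M /\ Cmod (/ PF q n) <= M)%R.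
Proof.
  intros Hq.
  assert (H1 : (Cmod ((q ^ 2) ^ 2) < 1)%R) by Cmod_lt_1.
  assert (H2 : (Cmod (- q ^ 2) < 1)%R) by Cmod_lt_1.
  assert (H3 : (Cmod (- (q ^ 2) ^ 2) < 1)%R) by Cmod_lt_1.
  destruct (qpoch_bound (- q ^ 2) _ H1) as [M1 B1].
  destruct (qpoch_inv_bound _ _ H2 H1) as [M2 B2].
  destruct (qpoch_bound (- (q ^ 2) ^ 2) _ H1) as [M3 B3].
  destruct (qpoch_inv_bound _ _ H3 H1) as [M4 B4].
  exists (Rmax (Rmax M1 M2) (Rmax M3 M4)); intros n.
  specialize (B1 n); specialize (B2 n); specialize (B3 n); specialize (B4 n).
  pose proof (Rmax_l (Rmax M1 M2) (Rmax M3 M4)); pose proof (Rmax_r (Rmax M1 M2) (Rmax M3 M4)).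
  pose proof (Rmax_l M1 M2); pose proof (Rmax_r M1 M2).
  pose proof (Rmax_l M3 M4); pose proof (Rmax_r M3 M4).
  unfold PE, PF; repeat split; lra.
Qed.

Lemma terms_bound (q : C) :
  (Cmod q < 1)%R ->
  exists K, forall n,
    (Cmod (S0_term (Cpow q 2) n) <= K * Cmod (q ^ 2) ^ n /\
     Cmod (S1_term (Cpow q 2) n) <= K * Cmod (q ^ 2) ^ n /\
     Cmod (T0_term (Cpow q 2) n) <= K * Cmod (q ^ 2) ^ n /\
     Cmod (T1_term (Cpow q 2) n) <= K * Cmod (q ^ 2) ^ n)%R.
Proof.
  intros Hq; destruct (PE_PF_bounds q Hq) as [M HM].
  assert (H : (Cmod (q ^ 2) < 1)%R) by Cmod_lt_1.
  exists (M * M)%R; intros n.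
  rewrite S0_term_q2, S1_term_q2, T0_term_q2, T1_term_q2; repeat split.
  - apply (pow_times_bounded (q ^ 2) (fun n => (n * n)%nat) (PE q) (fun n => / PF q n));
      [exact H|intros; nia|apply HM|apply HM].
  - apply (pow_times_bounded (q ^ 2) (fun n => (n * (n + 2))%nat) (PE q) (fun n => / PF q n));
      [exact H|intros; nia|apply HM|apply HM].
  - apply (pow_times_bounded (q ^ 2) (fun n => ((n + 1) * (n + 2))%nat) (PF q)
      (fun n => / PE q (S n))); [exact H|intros; nia|apply HM|intros; apply HM].
  - apply (pow_times_bounded (q ^ 2) (fun n => (n * (n + 1))%nat) (PF q)
      (fun n => / PE q (S n))); [exact H|intros; nia|apply HM|intros; apply HM].
Qed.

Lemma weight_bound (q : C) :
  (Cmod q < 1)%R ->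
  exists M, forall i j k l,
    (Cmod (/ (PA q i * PA q j * PC q k * PC q l)) <= M)%R.
Proof.
  intros Hq.
  assert (H1 : (Cmod (q ^ 2) < 1)%R) by Cmod_lt_1.
  assert (H2 : (Cmod (- q) < 1)%R) by Cmod_lt_1.
  destruct (qpoch_inv_bound _ _ H1 H1) as [M1 B1].
  destruct (qpoch_inv_bound _ _ H2 H1) as [M2 B2].
  exists (M1 * M1 * M2 * M2)%R; intros i j k l.
  replace (/ (PA q i * PA q j * PC q k * PC q l))
    with (/ PA q i * / PA q j * / PC q k * / PC q l)
    by (field; repeat split; auto using PA_neq_0, PC_neq_0).
  rewrite !Cmod_mult.
  repeat (apply Rmult_le_compat; repeat apply Rmult_le_pos; try apply Cmod_ge_0);
    first [apply B1 | apply B2].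
Qed.

Lemma weight_cv (q A B : C) (i j k l : nat -> nat) (c : nat) :
  (Cmod q < 1)%R -> qpoch_inf (q ^ 2) (q ^ 2) A -> qpoch_inf (- q) (q ^ 2) B ->
  (forall m, (m <= i m + c /\ m <= j m + c /\ m <= k m + c /\ m <= l m + c)%nat) ->
  Ccv (fun m => / (PA q (i m) * PA q (j m) * PC q (k m) * PC q (l m)))
    (/ (A * A * B * B)).
Proof.
  intros Hq HA HB Hc.
  assert (H1 : (Cmod (q ^ 2) < 1)%R) by Cmod_lt_1.
  assert (H2 : (Cmod (- q) < 1)%R) by Cmod_lt_1.
  assert (A0 : A <> 0) by exact (qpoch_inf_neq_0 _ _ _ H1 H1 HA).
  assert (B0 : B <> 0) by exact (qpoch_inf_neq_0 _ _ _ H2 H1 HB).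
  apply Ccv_inv; [repeat apply Cmult_neq_0; assumption|].
  assert (Hsub : forall f : nat -> nat, (forall m, (m <= f m + c)%nat) ->
            forall N, exists M, forall m, (M <= m)%nat -> (N <= f m)%nat).
  { intros f Hf N; exists (N + c)%nat; intros m; specialize (Hf m); lia. }
  repeat apply Ccv_mult.
  - apply (Ccv_subseq (PA q)); [apply Hsub; intros m; apply Hc|exact HA].
  - apply (Ccv_subseq (PA q)); [apply Hsub; intros m; apply Hc|exact HA].
  - apply (Ccv_subseq (PC q)); [apply Hsub; intros m; apply Hc|exact HB].
  - apply (Ccv_subseq (PC q)); [apply Hsub; intros m; apply Hc|exact HB].
Qed.

(** Here [B] is (-q;q^2)_oo. As m grows, the weighted sums tend to (U + V)/(A^2 B^2), while the
    closed form tends to B/(A D). *)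
Lemma bilateral_sum_eq_product (q U V A B D : C) :
  (Cmod q < 1)%R ->
  Cseries (pos_term q) U -> Cseries (neg_term q) V ->
  qpoch_inf (q ^ 2) (q ^ 2) A -> qpoch_inf (- q) (q ^ 2) B ->
  qpoch_inf (- q ^ 2) (q ^ 2) D ->
  U + V = A * B ^ 3 / D.
Proof.
  intros Hq HU HV HA HB HD.
  assert (H1 : (Cmod (q ^ 2) < 1)%R) by Cmod_lt_1.
  assert (H2 : (Cmod (- q) < 1)%R) by Cmod_lt_1.
  assert (H3 : (Cmod (- q ^ 2) < 1)%R) by Cmod_lt_1.
  assert (A0 : A <> 0) by exact (qpoch_inf_neq_0 _ _ _ H1 H1 HA).
  assert (B0 : B <> 0) by exact (qpoch_inf_neq_0 _ _ _ H2 H1 HB).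
  assert (D0 : D <> 0) by exact (qpoch_inf_neq_0 _ _ _ H3 H1 HD).
  destruct (terms_bound q Hq) as [K HK]; destruct (weight_bound q Hq) as [M HM].
  assert (Hr : (0 <= Cmod (q ^ 2) < 1)%R) by (split; [apply Cmod_ge_0|exact H1]).
  (* [pos_sum] has m + 1 terms, hence [S] for [phi]; [neg_sum] below has m terms, hence the
     identity. *)
  assert (P : Ccv (pos_sum q) (U * / (A * A * B * B))).
  { apply (tannery (pos_term q)
      (fun m k => / (PA q (m - k) * PA q (m - k + 2 * k) * PC q (m - k)
                     * PC q (S (m - k + 2 * k)))) _ _ (K + Cmod q * K) M (Cmod (q ^ 2)) S);
      auto.
    - intros k; destruct (HK k) as (B1 & B2 & _).
      rewrite pos_term_S0_S1; eapply Rle_trans; [apply Cmod_triangle|].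
      rewrite Cmod_mult; pose proof (Cmod_ge_0 q); nra.
    - intros k; apply (weight_cv q A B (fun m => (m - k)%nat) (fun m => (m - k + 2 * k)%nat)
        (fun m => (m - k)%nat) (fun m => S (m - k + 2 * k)) k); auto; intros; lia. }
  assert (N : Ccv (neg_sum q) (V * / (A * A * B * B))).
  { apply (tannery (neg_term q)
      (fun m k => / (PA q (m - S k) * PA q (S (S (m - S k + 2 * k))) * PC q (S (m - S k))
                     * PC q (S (S (m - S k + 2 * k))))) _ _ (2 * (K + Cmod q * K)) M
      (Cmod (q ^ 2)) (fun m => m)); auto.
    - intros k; destruct (HK k) as (_ & _ & B1 & B2).
      rewrite neg_term_T0_T1, Cmod_mult, Cmod_R, Rabs_pos_eq, Rmult_assoc by lra.
      apply Rmult_le_compat_l; [lra|].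
      eapply Rle_trans; [apply Cmod_triangle|].
      rewrite Cmod_mult; pose proof (Cmod_ge_0 q); nra.
    - intros k; apply (weight_cv q A B (fun m => (m - S k)%nat)
        (fun m => S (S (m - S k + 2 * k)))
        (fun m => S (m - S k)) (fun m => S (S (m - S k + 2 * k))) (S k)); auto; intros; lia. }
  assert (R : Ccv (fun m => pos_sum q m + neg_sum q m) (B * / (A * D))).
  { apply (Ccv_ext (fun m => PC q (2 * m) * / (PA q (2 * m) * PD q (2 * m)))).
    - intros m; symmetry; apply finite_identity, Hq.
    - assert (Hsub : forall N, exists M, forall n, (M <= n -> N <= 2 * n)%nat)
        by (intros n; exists n; intros; lia).
      apply Ccv_mult; [exact (Ccv_subseq (PC q) B _ Hsub HB)|].
      apply Ccv_inv; [now apply Cmult_neq_0|].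
      apply Ccv_mult; [exact (Ccv_subseq (PA q) A _ Hsub HA)
                      |exact (Ccv_subseq (PD q) D _ Hsub HD)]. }
  pose proof (Ccv_unique _ _ _ (Ccv_plus _ _ _ _ P N) R) as E.
  replace (U + V) with ((U * / (A * A * B * B) + V * / (A * A * B * B)) * (A * A * B * B))
    by (field; repeat split; assumption).
  rewrite E; field; repeat split; assumption.
Qed.

(** * Separation of the two claims by the substitution of -q for q *)

Lemma Cseries_linear (f g : nat -> C) (c d F G : C) :
  Cseries f F -> Cseries g G ->
  Cseries (fun n => d * (f n + c * g n)) (d * (F + c * G)).
Proof.
  intros HF HG.
  apply (Ccv_ext (fun n => d * (Cpsum f n + c * Cpsum g n))).
  - intros n; rewrite Cpsum_scal, Cpsum_plus, Cpsum_scal; reflexivity.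
  - apply Ccv_mult; [apply Ccv_const|apply Ccv_plus; [exact HF|]].
    apply Ccv_mult; [apply Ccv_const|exact HG].
Qed.

Lemma mock_theta_combination (q s0 s1 t0 t1 A B D : C) :
  (Cmod q < 1)%R ->
  Cseries (S0_term (Cpow q 2)) s0 -> Cseries (S1_term (Cpow q 2)) s1 ->
  Cseries (T0_term (Cpow q 2)) t0 -> Cseries (T1_term (Cpow q 2)) t1 ->
  qpoch_inf (q ^ 2) (q ^ 2) A -> qpoch_inf (- q) (q ^ 2) B ->
  qpoch_inf (- q ^ 2) (q ^ 2) D ->
  s0 + 2 * t0 + q * (s1 + 2 * t1) = A * B ^ 3 / D.
Proof.
  intros Hq Hs0 Hs1 Ht0 Ht1 HA HB HD.
  rewrite <- (bilateral_sum_eq_product q (1 * (s0 + q * s1)) (2 * (t0 + q * t1)) A B D Hq);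
    [ring| | |exact HA|exact HB|exact HD].
  - pose proof (Cseries_linear _ _ q 1 _ _ Hs0 Hs1) as H.
    apply (Ccv_ext (Cpsum (fun n => 1 * (S0_term (Cpow q 2) n + q * S1_term (Cpow q 2) n))));
      [|exact H].
    intros n; apply Cpsum_ext; intros k _; rewrite pos_term_S0_S1; ring.
  - pose proof (Cseries_linear _ _ q 2 _ _ Ht0 Ht1) as H.
    apply (Ccv_ext (Cpsum (fun n => 2 * (T0_term (Cpow q 2) n + q * T1_term (Cpow q 2) n))));
      [|exact H].
    intros n; apply Cpsum_ext; intros k _; now rewrite neg_term_T0_T1.
Qed.

(** Half the sum of the two equations gives x; half their difference gives q y. *)
Lemma even_odd_parts (x y b c A D q : C) :
  D <> 0 -> x + q * y = A * c ^ 3 / D -> x + - q * y = A * b ^ 3 / D ->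
  x = A * (b ^ 3 + c ^ 3) / (2 * D) /\
  (q <> 0 -> y = A * (c ^ 3 - b ^ 3) / (2 * q * D)).
Proof.
  intros HD H1 H2.
  assert (T : (2 : C) <> 0) by (intros E; apply RtoC_inj in E; lra).
  split.
  - replace x with (((x + q * y) + (x + - q * y)) / 2) by (field; assumption).
    rewrite H1, H2; field; repeat split; assumption.
  - intros Hq.
    replace y with (((x + q * y) - (x + - q * y)) / (2 * q)) by (field; repeat split; assumption).
    rewrite H1, H2; field; repeat split; assumption.
Qed.

Local Close Scope C_scope.

Theorem mainTheorem13 (q : Cx) (hq : Cnorm q < 1) :
  (exists s0 t0 A B Cc D : Cx,
     Cseries (S0_term (Cpow q 2)) s0 /\
     Cseries (T0_term (Cpow q 2)) t0 /\
     qpoch_inf (Cpow q 2) (Cpow q 2) A /\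
     qpoch_inf q (Cpow q 2) B /\
     qpoch_inf (Copp q) (Cpow q 2) Cc /\
     qpoch_inf (Copp (Cpow q 2)) (Cpow q 2) D /\
     Cadd s0 (Cmul (RtoC 2) t0) =
       Cdiv (Cmul A (Cadd (Cpow B 3) (Cpow Cc 3))) (Cmul (RtoC 2) D))
  /\
  (q <> C0 ->
   exists s1 t1 A B Cc D : Cx,
     Cseries (S1_term (Cpow q 2)) s1 /\
     Cseries (T1_term (Cpow q 2)) t1 /\
     qpoch_inf (Cpow q 2) (Cpow q 2) A /\
     qpoch_inf q (Cpow q 2) B /\
     qpoch_inf (Copp q) (Cpow q 2) Cc /\
     qpoch_inf (Copp (Cpow q 2)) (Cpow q 2) D /\
     Cadd s1 (Cmul (RtoC 2) t1) =
       Cdiv (Cmul A (Csub (Cpow Cc 3) (Cpow B 3)))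
            (Cmul (Cmul (RtoC 2) q) D)).
Proof.
  rewrite Cnorm_Cmod in hq.
  assert (H1 : Cmod (q ^ 2) < 1) by Cmod_lt_1.
  assert (H2 : Cmod (- q ^ 2) < 1) by Cmod_lt_1.
  assert (Hr : 0 <= Cmod (q ^ 2) < 1) by (split; [apply Cmod_ge_0|exact H1]).
  destruct (terms_bound q hq) as [K HK].
  destruct (Cseries_geometric_bound _ K _ Hr (fun n => proj1 (HK n))) as [s0 Hs0].
  destruct (Cseries_geometric_bound _ K _ Hr (fun n => proj1 (proj2 (HK n)))) as [s1 Hs1].
  destruct (Cseries_geometric_bound _ K _ Hr (fun n => proj1 (proj2 (proj2 (HK n))))) as [t0 Ht0].
  destruct (Cseries_geometric_bound _ K _ Hr (fun n => proj2 (proj2 (proj2 (HK n))))) as [t1 Ht1].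
  destruct (qpoch_cv (q ^ 2) _ H1) as [A HA].
  destruct (qpoch_cv q _ H1) as [B HB].
  destruct (qpoch_cv (- q) _ H1) as [Cc HC].
  destruct (qpoch_cv (- q ^ 2) _ H1) as [D HD].
  assert (D0 : D <> (0 : C)) by exact (qpoch_inf_neq_0 _ _ _ H2 H1 HD).
  pose proof (mock_theta_combination q s0 s1 t0 t1 A Cc D hq Hs0 Hs1 Ht0 Ht1 HA HC HD) as E1.
  (* Replacing q by -q fixes q^2, hence the four series, [A] and [D], and puts [B] in the place of
     [Cc]. *)
  assert (Eopp : (- - q = q)%C) by ring.
  assert (Esq : ((- q) ^ 2 = q ^ 2)%C) by ring.
  assert (Esq' : Cpow (- q)%C 2 = Cpow q 2) by (rewrite !Cpow_Coquelicot; exact Esq).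
  assert (E2 : (s0 + 2 * t0 + - q * (s1 + 2 * t1) = A * B ^ 3 / D)%C).
  { apply mock_theta_combination; rewrite ?Esq', ?Esq, ?Cmod_opp, ?Eopp; assumption. }
  destruct (even_odd_parts _ _ _ _ _ _ _ D0 E1 E2) as [F0 F1].
  rewrite <- (Cpow_Coquelicot q 2) in HA, HB, HC, HD.
  split; [exists s0, t0, A, B, Cc, D | intros Hq; exists s1, t1, A, B, Cc, D];
    repeat (split; [assumption|]); rewrite Cdiv_Coquelicot, !Cpow_Coquelicot.
  - exact F0.
  - exact (F1 Hq).
Qed.
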